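(* Let $\hat x\in\mathcal X$ be a given leader's decision, and consider the second-stage semidefinite program under the discrete ambiguity set $\mathcal D_{\mathrm{dis}}$, $$\min_{Q,q,r,t,\lambda,p^s,y^s}\ r+t$$ subject to $$r\ge b_{\hat x}(\xi^s)^\top p^s+c(\xi^s)^\top y^s-{\xi^s}^\top Q\xi^s-{\xi^s}^\top q,\quad s=1,\dots,N,\qquad(\ast)$$ $$A^\top p^s+\lambda c(\xi^s)=v(\xi^s),\quad p^s\ge0,\quad Ay^s\le\lambda b_{\hat x}(\xi^s),\quad s=1,\dots,N,$$ $$t\ge(\gamma_2\Sigma_0+\mu_0\mu_0^\top)\cdot Q+\mu_0^\top q+\sqrt{\gamma_1}\,\|\Sigma_0^{1/2}(q+2Q\mu_0)\|,\quad Q\succeq0,\ \lambda\ge0.$$ Let $\gamma^*=(\gamma^{1*},\dots,\gamma^{N*})\in\mathbb R^N$ be the optimal dual solution associated with the constraints $(\ast)$. Then the worst-case distribution is characterized by $\mathbb P\{\xi=\xi^s\}=\gamma^{s*}$, $s=1,\dots,N$; that is, this distribution belongs to $\mathcal D_{\mathrm{dis}}$ and attains $\sup_{F\in\mathcal D_{\mathrm{dis}}}\mathbb E_F[\Psi(\hat x,\xi)]$.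
   Context: Data. $\mathcal X\subseteq\{0,1\}^d$, $A\in\mathbb R^{m\times n}$; $c(\xi)=C\xi+c_0$, $v(\xi)=V\xi+v_0$ with $C,V\in\mathbb R^{n\times k}$, $c_0,v_0\in\mathbb R^n$; $b_x(\xi)=B_x\xi+b_{x0}$ with $B_x=\sum_{i=1}^dB_ix_i+B_0$, $b_{x0}=\sum_{i=1}^db_ix_i+b_0$, $B_i\in\mathbb R^{m\times k}$, $b_i\in\mathbb R^m$. $\Omega(x,\xi)=\arg\min_y\{c(\xi)^\top y:Ay\le b_x(\xi)\}$ is the set of all optimal follower's solutions and $\Psi(x,\xi)=\max_{y\in\Omega(x,\xi)}v(\xi)^\top y$. Ambiguity set. $\xi$ is supported on the finite set $\{\xi^1,\dots,\xi^N\}\subset\mathbb R^k$. Given $\mu_0\in\mathbb R^k$, a symmetric positive definite $\Sigma_0\in\mathbb R^{k\times k}$, $\gamma_1\ge0$, $\gamma_2\ge1$, $\mathcal D_{\mathrm{dis}}$ is the set of $p\in\mathbb R_+^N$ (identified with the distributions $\mathbb P(\xi=\xi^s)=p_s$) such that $\sum_sp_s=1$, $\big(\sum_sp_s\xi^s-\mu_0\big)^\top\Sigma_0^{-1}\big(\sum_sp_s\xi^s-\mu_0\big)\le\gamma_1$ and $\sum_sp_s(\xi^s-\mu_0)(\xi^s-\mu_0)^\top\preceq\gamma_2\Sigma_0$. Standing assumption (relatively complete recourse). $\{y\in\mathbb R^n:Ay\le b_x(\xi^s)\}$ is nonempty and bounded for every $x\in\mathcal X$ and every $s$. Variables of the primal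 program: $Q\in\mathbb R^{k\times k}$ symmetric, $q\in\mathbb R^k$, $r,t,\lambda\in\mathbb R$, $p^s\in\mathbb R^m$, $y^s\in\mathbb R^n$. $X\cdot Y=\mathrm{Tr}(X^\top Y)$. The dual program, with $\gamma^s$ the multiplier of the $s$-th constraint in $(\ast)$, is: maximize $\sum_{s=1}^N{\chi^s}^\top v(\xi^s)$ over $\gamma^s\in\mathbb R$, $\sigma^s\in\mathbb R^m$, $\chi^s\in\mathbb R^n$, $\mu\in\mathbb R^k$ subject to $\gamma_2\Sigma_0+\mu_0\mu_0^\top-\sum_s\gamma^s\xi^s{\xi^s}^\top+\sqrt{\gamma_1}(\mu_0\mu^\top\Sigma_0^{1/2}+\Sigma_0^{1/2}\mu\mu_0^\top)\succeq0$; $\sum_s\gamma^s=1$; $\sqrt{\gamma_1}\Sigma_0^{1/2}\mu+\mu_0-\sum_s\gamma^s\xi^s=0$; $\|\mu\|_2\le1$; $-A\chi^s+\gamma^sb_{\hat x}(\xi^s)\ge0$ and $\gamma^sc(\xi^s)+A^\top\sigma^s=0$ for all $s$; $\sum_s({\chi^s}^\top c(\xi^s)+{\sigma^s}^\top b_{\hat x}(\xi^s))\le0$; $\gamma^s\ge0$, $\sigma^s\ge0$ for all $s$. *)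

(* Defs.v *)
(* Vectors are columns; R is an arbitrary realType of MathComp-Analysis. *)
From HB Require Import structures.
From mathcomp Require Import all_boot all_order all_algebra.
From mathcomp Require Import ring lra.
From mathcomp Require Import all_classical all_reals all_analysis.

Set Implicit Arguments.
Unset Strict Implicit.
Unset Printing Implicit Defensive.

Import Order.TTheory GRing.Theory Num.Theory.
Import numFieldNormedType.Exports.

Local Open Scope classical_set_scope.
Local Open Scope ring_scope.

Section LinearAlgebra.
Variable R : realType.

Definition dotv n (u v : 'cV[R]_n) : R := (u^T *m v) 0 0.

(* The library norm `|u| on matrices is the sup norm, hence this definition. *)
Definition norm2 n (u : 'cV[R]_n) : R := Num.sqrt (dotv u u).

Definition lev n (u v : 'cV[R]_n) : Prop := forall i, u i 0 <= v i 0.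

Definition mxdot n (X Y : 'M[R]_n) : R := \tr (X^T *m Y).

Definition psd n (M : 'M[R]_n) : Prop :=
  M^T = M /\ forall u : 'cV[R]_n, 0 <= dotv u (M *m u).

Definition posdef n (M : 'M[R]_n) : Prop :=
  M^T = M /\ forall u : 'cV[R]_n, u != 0 -> 0 < dotv u (M *m u).

Definition loewner_le n (M P : 'M[R]_n) : Prop := psd (P - M).

(* S is M^{1/2}: for M positive semidefinite, this determines S uniquely. *)
Definition is_psd_sqrt n (M S : 'M[R]_n) : Prop := psd S /\ S *m S = M.

End LinearAlgebra.

Section Model.
Variables (R : realType) (d m n k N : nat).

(* A leader's decision x in {0,1}^d is a function 'I_d -> bool, whose values
   enter the affine expressions below as (x i)%:R. *)
Record follower_data := FollowerData {
  mxA : 'M[R]_(m, n);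
  mxC : 'M[R]_(n, k);
  vec_c0 : 'cV[R]_n;
  mxV : 'M[R]_(n, k);
  vec_v0 : 'cV[R]_n;
  mxB : 'I_d -> 'M[R]_(m, k);
  mxB0 : 'M[R]_(m, k);
  vec_b : 'I_d -> 'cV[R]_m;
  vec_b0 : 'cV[R]_m }.

Record ambiguity_data := AmbiguityData {
  scen : 'I_N -> 'cV[R]_k;
  mu0 : 'cV[R]_k;
  Sigma0 : 'M[R]_k;
  gamma1 : R;
  gamma2 : R }.

Variables (F : follower_data) (G : ambiguity_data).
Local Notation A := (mxA F).
Local Notation xi := (scen G).

Definition cost_c (z : 'cV[R]_k) : 'cV[R]_n := mxC F *m z + vec_c0 F.

Definition cost_v (z : 'cV[R]_k) : 'cV[R]_n := mxV F *m z + vec_v0 F.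

Definition rhs_b (x : {ffun 'I_d -> bool}) (z : 'cV[R]_k) : 'cV[R]_m :=
  (\sum_i (x i)%:R *: mxB F i + mxB0 F) *m z
  + (\sum_i (x i)%:R *: vec_b F i + vec_b0 F).

Definition follower_feasible (x : {ffun 'I_d -> bool}) (z : 'cV[R]_k) :
    set 'cV[R]_n :=
  [set y | lev (A *m y) (rhs_b x z)].

Definition Omega (x : {ffun 'I_d -> bool}) (z : 'cV[R]_k) : set 'cV[R]_n :=
  [set y | follower_feasible x z y /\
     forall y', follower_feasible x z y' ->
       dotv (cost_c z) y <= dotv (cost_c z) y'].

(* Under relatively complete recourse Omega x (xi s) is a nonempty compact set,
   so that this supremum is a maximum. *)
Definition Psi (x : {ffun 'I_d -> bool}) (z : 'cV[R]_k) : R :=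
  sup [set dotv (cost_v z) y | y in Omega x z].

Definition relatively_complete_recourse (X : {set {ffun 'I_d -> bool}}) :
    Prop :=
  forall (x : {ffun 'I_d -> bool}) (s : 'I_N), x \in X ->
    follower_feasible x (xi s) !=set0 /\
    bounded_set (follower_feasible x (xi s)).

(* A distribution on the scenarios is identified with its weight vector p,
   P(xi = xi^s) = p s. *)
Definition Ddis : set ('I_N -> R) :=
  [set p |
    [/\ forall s, 0 <= p s,
        \sum_s p s = 1,
        (let e := \sum_s p s *: xi s - mu0 G in
         dotv e (invmx (Sigma0 G) *m e) <= gamma1 G) &
        loewner_le
          (\sum_s p s *: ((xi s - mu0 G) *m (xi s - mu0 G)^T))
          (gamma2 G *: Sigma0 G)]].

Definition expected_Psi (x : {ffun 'I_d -> bool}) (p : 'I_N -> R) : R :=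
  \sum_s p s * Psi x (xi s).

Record primal_point := PrimalPoint {
  prQ : 'M[R]_k;
  prq : 'cV[R]_k;
  prr : R;
  prt : R;
  prlam : R;
  prp : 'I_N -> 'cV[R]_m;
  pry : 'I_N -> 'cV[R]_n }.

Definition primal_objective (P : primal_point) : R := prr P + prt P.

Definition epigraph_rhs (x : {ffun 'I_d -> bool}) (P : primal_point)
    (s : 'I_N) : R :=
  dotv (rhs_b x (xi s)) (prp P s) + dotv (cost_c (xi s)) (pry P s)
  - dotv (xi s) (prQ P *m xi s) - dotv (xi s) (prq P).

(* The N constraints dualized by the multipliers gamma^s. *)
Definition epigraph_constraints (x : {ffun 'I_d -> bool}) (P : primal_point) :
    Prop :=
  forall s, epigraph_rhs x P s <= prr P.

(* All the other constraints; Sh stands for Sigma0^{1/2}. *)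
Definition other_primal_constraints (Sh : 'M[R]_k) (x : {ffun 'I_d -> bool})
    (P : primal_point) : Prop :=
  [/\ forall s, [/\ A^T *m prp P s + prlam P *: cost_c (xi s) = cost_v (xi s),
                    lev 0 (prp P s) &
                    lev (A *m pry P s) (prlam P *: rhs_b x (xi s))],
      mxdot (gamma2 G *: Sigma0 G + mu0 G *m (mu0 G)^T) (prQ P)
        + dotv (mu0 G) (prq P)
        + Num.sqrt (gamma1 G)
          * norm2 (Sh *m (prq P + 2%:R *: (prQ P *m mu0 G))) <= prt P,
      psd (prQ P) &
      0 <= prlam P].

Definition primal_feasible (Sh : 'M[R]_k) (x : {ffun 'I_d -> bool})
    (P : primal_point) : Prop :=
  epigraph_constraints x P /\ other_primal_constraints Sh x P.

Record dual_point := DualPoint {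
  dgamma : 'I_N -> R;
  dsigma : 'I_N -> 'cV[R]_m;
  dchi : 'I_N -> 'cV[R]_n;
  dmu : 'cV[R]_k }.

Definition dual_objective (D : dual_point) : R :=
  \sum_s dotv (dchi D s) (cost_v (xi s)).

Definition dual_feasible (Sh : 'M[R]_k) (x : {ffun 'I_d -> bool})
    (D : dual_point) : Prop :=
  [/\ psd (gamma2 G *: Sigma0 G + mu0 G *m (mu0 G)^T
           - \sum_s dgamma D s *: (xi s *m (xi s)^T)
           + Num.sqrt (gamma1 G) *: (mu0 G *m (dmu D)^T *m Sh
                                     + Sh *m dmu D *m (mu0 G)^T)),
      \sum_s dgamma D s = 1,
      Num.sqrt (gamma1 G) *: (Sh *m dmu D) + mu0 G
        - \sum_s dgamma D s *: xi s = 0,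
      norm2 (dmu D) <= 1 &
    [/\ forall s, lev 0 (- (A *m dchi D s) + dgamma D s *: rhs_b x (xi s)),
        forall s, dgamma D s *: cost_c (xi s) + A^T *m dsigma D s = 0,
        \sum_s (dotv (dchi D s) (cost_c (xi s))
                + dotv (dsigma D s) (rhs_b x (xi s))) <= 0,
        forall s, 0 <= dgamma D s &
        forall s, lev 0 (dsigma D s)]].

Definition dual_optimal (Sh : 'M[R]_k) (x : {ffun 'I_d -> bool})
    (D : dual_point) : Prop :=
  dual_feasible Sh x D /\
  forall D', dual_feasible Sh x D' -> dual_objective D' <= dual_objective D.

End Model.

Section PsdTrace.
Variable R : realType.

Lemma dotvE n (u v : 'cV[R]_n) : dotv u v = \sum_i u i 0 * v i 0.
Proof. by rewrite /dotv mxE; apply: eq_bigr => i _; rewrite mxE. Qed.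

Lemma dotvC n (u v : 'cV[R]_n) : dotv u v = dotv v u.
Proof. by rewrite !dotvE; apply: eq_bigr => i _; rewrite mulrC. Qed.

Lemma dotvDr n (u v w : 'cV[R]_n) : dotv u (v + w) = dotv u v + dotv u w.
Proof. by rewrite /dotv mulmxDr mxE. Qed.

Lemma dotvDl n (u v w : 'cV[R]_n) : dotv (u + v) w = dotv u w + dotv v w.
Proof. by rewrite dotvC dotvDr !(dotvC w). Qed.

Lemma dotvZr n a (u v : 'cV[R]_n) : dotv u (a *: v) = a * dotv u v.
Proof. by rewrite /dotv -scalemxAr mxE. Qed.

Lemma dotvZl n a (u v : 'cV[R]_n) : dotv (a *: u) v = a * dotv u v.
Proof. by rewrite dotvC dotvZr dotvC. Qed.

Lemma dotv0r n (u : 'cV[R]_n) : dotv u 0 = 0.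
Proof. by rewrite /dotv mulmx0 mxE. Qed.

Lemma dotv0l n (u : 'cV[R]_n) : dotv 0 u = 0.
Proof. by rewrite dotvC dotv0r. Qed.

Lemma dotv_suml n (I : finType) (f : I -> 'cV[R]_n) v :
  dotv (\sum_i f i) v = \sum_i dotv (f i) v.
Proof.
by rewrite dotvC /dotv mulmx_sumr summxE; apply: eq_bigr => i _; exact: dotvC.
Qed.

Lemma dotv_adj m n (M : 'M[R]_(m, n)) u v :
  dotv u (M *m v) = dotv (M^T *m u) v.
Proof. by rewrite /dotv trmx_mul trmxK mulmxA. Qed.

Lemma dotv_ge0 n (u : 'cV[R]_n) : 0 <= dotv u u.
Proof. by rewrite dotvE; apply: sumr_ge0 => i _; rewrite -expr2 sqr_ge0. Qed.

Lemma lev_dotv n (u v w : 'cV[R]_n) : lev 0 w -> lev u v ->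
  dotv w u <= dotv w v.
Proof.
move=> w0 uv; rewrite !dotvE; apply: ler_sum => i _; apply: ler_wpM2l => //.
by have := w0 i; rewrite mxE.
Qed.

Lemma dotv_CauchySchwarz n (u v : 'cV[R]_n) : dotv u v <= norm2 u * norm2 v.
Proof.
rewrite /norm2 -sqrtrM ?dotv_ge0//.
apply: le_trans (ler_norm _) _; rewrite -sqrtr_sqr; apply: ler_wsqrtr.
have [v0|v0] := eqVneq (dotv v v) 0.
  have : forall t, 0 <= dotv u u + 2 * t * dotv u v.
    move=> t; have := dotv_ge0 (u + t *: v).
    rewrite !dotvDl !dotvDr !dotvZl !dotvZr v0 (dotvC v u).
    by move=> h; apply: le_trans h _; lra.
  have [-> _|uv0 h] := eqVneq (dotv u v) 0; first by rewrite v0; lra.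
  have := h (- (dotv u u + 1) / (2 * dotv u v)).
  suff -> : dotv u u + 2 * (- (dotv u u + 1) / (2 * dotv u v)) * dotv u v = -1.
    by lra.
  by field.
have vp : 0 < dotv v v by rewrite lt_def v0 dotv_ge0.
have := dotv_ge0 (dotv v v *: u - dotv u v *: v).
rewrite -scaleNr !dotvDl !dotvDr !dotvZl !dotvZr (dotvC v u).
set a := dotv v v in vp *; set b := dotv u v; set c := dotv u u => h.
have : 0 <= a * (c * a - b ^+ 2) by apply: le_trans h _; rewrite expr2; lra.
by rewrite pmulr_rge0// subr_ge0.
Qed.

Lemma psd_deflate n (Q : 'M[R]_n) (e : 'cV[R]_n) : psd Q ->
  0 < dotv e (Q *m e) ->
  psd (Q - (dotv e (Q *m e))^-1 *: ((Q *m e) *m (Q *m e)^T)).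
Proof.
move=> [Qs Qp] a0; split.
  by rewrite linearB /= linearZ /= trmx_mul trmxK Qs.
move=> u; set a := dotv e _ in a0 *.
have E (w z : 'cV[R]_n) : dotv u ((w *m z^T) *m u) = dotv u w * dotv z u.
  rewrite /dotv -mulmxA mulmxA [LHS]mxE big_ord1.
  by congr (_ * _); congr (fun_of_matrix _ _ _).
rewrite mulmxBl -scalemxAl -scaleN1r dotvDr !dotvZr E.
have := Qp (u - (a^-1 * dotv u (Q *m e)) *: e).
rewrite -scaleNr mulmxDr -scalemxAr !dotvDl !dotvDr !dotvZl !dotvZr -/a.
have -> : dotv e (Q *m u) = dotv u (Q *m e) by rewrite dotv_adj Qs dotvC.
rewrite (dotvC (Q *m e) u); set b := dotv u (Q *m e).
suff -> : forall c, c + - (a^-1 * b) * b +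
  (- (a^-1 * b) * b + - (a^-1 * b) * (- (a^-1 * b) * a)) =
  c + -1 * (a^-1 * (b * b)) by [].
by move=> c; field; rewrite gt_eqF.
Qed.

Lemma dotv_delta n (Q : 'M[R]_n) i j :
  dotv (delta_mx i 0) (Q *m delta_mx j 0) = Q i j.
Proof. by rewrite -colE dotvE (bigD1 i)//= big1 ?addr0 => [|l /negbTE li];
  rewrite !mxE ?eqxx ?mul1r// li mul0r. Qed.

Lemma psd_trace_ge0 n (M Q : 'M[R]_n) : psd M -> psd Q -> 0 <= \tr (M *m Q).
Proof.
move=> [_ Mp]; have [h] := ubnP #|[set i | Q i i != 0]%SET|.
elim: h Q => // h IH Q; rewrite ltnS => Qh Qpsd; have [Qs Qp] := Qpsd.
have Qd i : 0 <= Q i i by rewrite -dotv_delta Qp.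
have [[i Qi]|] := pselect (exists i, Q i i != 0); last first.
  move=> Q0; have {}Q0 i : Q i i = 0.
    by apply/eqP/negPn/negP => Qi; apply: Q0; exists i.
  suff -> : Q = 0 by rewrite mulmx0 mxtrace0.
  apply/matrixP => i j; rewrite mxE.
  have Qji : Q j i = Q i j by rewrite -{1}Qs mxE.
  have := Qp (delta_mx i 0 + delta_mx j 0).
  have := Qp (delta_mx i 0 - delta_mx j 0).
  rewrite -scaleN1r !mulmxDr -!scalemxAr !dotvDl !dotvDr !dotvZl !dotvZr.
  rewrite !dotv_delta !Q0 Qji; lra.
set e : 'cV[R]_n := delta_mx i 0.
have eE : dotv e (Q *m e) = Q i i by exact: dotv_delta.
have e0 : 0 < dotv e (Q *m e) by rewrite eE lt_def Qi Qd.
set Q' := Q - (dotv e (Q *m e))^-1 *: ((Q *m e) *m (Q *m e)^T).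
have Q'psd : psd Q' by exact: psd_deflate.
have Q'd j : Q' j j = Q j j - (Q i i)^-1 * Q j i ^+ 2.
  rewrite /Q' eE !mxE big_ord1 -colE !mxE expr2; by [].
have Q'd0 j : 0 <= Q' j j by rewrite -dotv_delta; apply Q'psd.2.
have -> : Q = Q' + (dotv e (Q *m e))^-1 *: ((Q *m e) *m (Q *m e)^T).
  by rewrite subrK.
rewrite mulmxDr mxtraceD -scalemxAr mxtraceZ addr_ge0//; last first.
  rewrite mulr_ge0 ?invr_ge0 ?(ltW e0)// mulmxA mxtrace_mulC.
  by rewrite /mxtrace big_ord1; exact: Mp.
apply: IH => //; apply: leq_trans Qh; apply: proper_card; apply/properP; split.
  apply/fintype.subsetP => j; rewrite !inE; apply: contraNN => /eqP Qj.
  have := Q'd0 j; rewrite Q'd Qj.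
  have : 0 <= (Q i i)^-1 * Q j i ^+ 2 by rewrite mulr_ge0 ?sqr_ge0 ?invr_ge0.
  by move=> *; apply/eqP; lra.
exists i; rewrite !inE// negbK Q'd; apply/eqP; field; exact: Qi.
Qed.

End PsdTrace.

(* The objective of the dual program is a lower bound of the Lagrangian that
   attaches the multipliers gamma^s to the epigraph constraints of the primal
   program; on primal feasible points this gives weak duality. *)
Lemma dual_objective_le_lagrangian (R : realType) (d m n k N : nat)
    (F : follower_data R d m n k) (G : ambiguity_data R k N)
    (Sh : 'M[R]_k) (x : {ffun 'I_d -> bool})
    (P : primal_point R m n k N) (D : dual_point R m n k N) :
  psd Sh -> other_primal_constraints F G Sh x P -> dual_feasible F G Sh x D ->
  dual_objective F G D <=
    primal_objective P
    + \sum_s dgamma D s * (epigraph_rhs F G x P s - prr P).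
Proof.
case: P => Q q r t lam p y; case: D => g sg ch mu [Shs _].
rewrite /other_primal_constraints /dual_feasible /dual_objective
  /primal_objective /epigraph_rhs /=.
move=> [PC Pt Qpsd lam0] [Mpsd g1 Dm mu1 [Dch Dsg Dle g0 sg0]].
have Qs := Qpsd.1.
pose b s := rhs_b F x (scen G s); pose c s := cost_c F (scen G s).
pose a := Num.sqrt (gamma1 G).
have a0 : 0 <= a by exact: sqrtr_ge0.
pose z s := scen G s; pose w := q + 2%:R *: (Q *m mu0 G).
have L1 : \sum_s dotv (ch s) (cost_v F (z s)) <=
    \sum_s g s * (dotv (b s) (p s) + dotv (c s) (y s)).
  have E s : dotv (ch s) (cost_v F (z s)) <=
      g s * dotv (b s) (p s) + lam * dotv (ch s) (c s).
    have [<- p0 _] := PC s; rewrite dotvDr dotvZr dotv_adj trmxK lerD2r.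
    rewrite -dotvZl dotvC (dotvC _ (p s)); apply: lev_dotv => // i.
    by have := Dch s i; rewrite !mxE; lra.
  have E' s : - (lam * dotv (sg s) (b s)) <= g s * dotv (c s) (y s).
    have [_ _ Ay] := PC s; have := lev_dotv (sg0 s) Ay.
    have/eqP := Dsg s; rewrite addrC addr_eq0 => /eqP AE.
    by rewrite dotv_adj AE dotvZr -scaleN1r !dotvZl -/(b s) -/(c s); lra.
  apply: le_trans (ler_sum _ (fun s _ => E s)) _.
  have : \sum_s - (lam * dotv (sg s) (b s)) <= \sum_s g s * dotv (c s) (y s).
    exact: ler_sum.
  have := ler_wpM2l lam0 Dle.
  rewrite mulr0 big_split/= mulrDr !mulr_sumr sumrN -/b -/c.
  under [X in _ -> _ -> _ <= X]eq_bigr do rewrite mulrDr.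
  by rewrite !big_split/= /b /c; lra.
have trE (u v : 'cV[R]_k) : \tr (u *m v^T *m Q) = dotv v (Q *m u).
  by rewrite -mulmxA mxtrace_mulC /mxtrace big_ord1 /dotv mulmxA.
have L2 : \sum_s g s * (dotv (z s) (Q *m z s) + dotv (z s) q) <= t.
  apply: le_trans Pt; rewrite -/a -/w.
  have := psd_trace_ge0 Mpsd Qpsd.
  have trN (Y : 'M[R]_k) : \tr (- Y) = - \tr Y by exact: raddfN.
  have trS (Y : 'I_N -> 'M[R]_k) : \tr (\sum_i Y i) = \sum_i \tr (Y i).
    exact: raddf_sum.
  rewrite -/a !mulmxDl mulNmx -!scalemxAl !mxtraceD trN !mxtraceZ mulmxDl.
  rewrite mxtraceD mulmx_suml trS trE.
  have -> : \sum_i \tr (g i *: (scen G i *m (scen G i)^T) *m Q) =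
      \sum_i g i * dotv (z i) (Q *m z i).
    by apply: eq_bigr => i _; rewrite -scalemxAl mxtraceZ trE.
  have -> : mu0 G *m mu^T *m Sh = mu0 G *m (Sh *m mu)^T.
    by rewrite trmx_mul Shs mulmxA.
  rewrite !trE.
  have -> : dotv (mu0 G) (Q *m (Sh *m mu)) = dotv (Sh *m mu) (Q *m mu0 G).
    by rewrite dotv_adj Qs dotvC.
  have -> : mxdot (gamma2 G *: Sigma0 G + mu0 G *m (mu0 G)^T) Q =
      gamma2 G * \tr (Sigma0 G *m Q) + dotv (mu0 G) (Q *m mu0 G).
    rewrite /mxdot -mxtrace_tr trmx_mul trmxK Qs mxtrace_mulC.
    by rewrite mulmxDl mxtraceD trE -scalemxAl mxtraceZ.
  have CS : dotv mu (Sh *m w) <= norm2 (Sh *m w).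
    apply: le_trans (dotv_CauchySchwarz _ _) _.
    by rewrite ler_piMl ?sqrtr_ge0.
  have := ler_wpM2l a0 CS.
  have -> : dotv mu (Sh *m w) = dotv (Sh *m mu) q
      + 2 * dotv (Sh *m mu) (Q *m mu0 G).
    by rewrite dotv_adj Shs dotvDr dotvZr.
  have : \sum_s g s * dotv (z s) q = a * dotv (Sh *m mu) q + dotv (mu0 G) q.
    rewrite -dotvZl -dotvDl; move/eqP: Dm; rewrite subr_eq0 => /eqP ->.
    by rewrite dotv_suml; apply: eq_bigr => s _; rewrite dotvZl.
  move=> zq; under [X in _ -> _ -> X <= _]eq_bigr do rewrite mulrDr.
  by rewrite big_split/= zq; lra.
have -> : \sum_s g s * (dotv (b s) (p s) + dotv (c s) (y s)
      - dotv (z s) (Q *m z s) - dotv (z s) q - r) =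
    \sum_s g s * (dotv (b s) (p s) + dotv (c s) (y s))
    - \sum_s g s * (dotv (z s) (Q *m z s) + dotv (z s) q) - r.
  rewrite -[X in _ = _ - _ - X]mul1r -g1 mulr_suml -!sumrB.
  by apply: eq_bigr => s _; ring.
by lra.
Qed.

Lemma weak_duality (R : realType) (d m n k N : nat)
    (F : follower_data R d m n k) (G : ambiguity_data R k N)
    (Sh : 'M[R]_k) (x : {ffun 'I_d -> bool})
    (P : primal_point R m n k N) (D : dual_point R m n k N) :
  psd Sh -> primal_feasible F G Sh x P -> dual_feasible F G Sh x D ->
  dual_objective F G D <= primal_objective P.
Proof.
move=> Sp [Pe Po] Df; apply: le_trans (dual_objective_le_lagrangian Sp Po Df) _.
rewrite gerDl; apply: sumr_le0 => s _; rewrite mulr_ge0_le0 ?subr_le0//.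
by case: Df => _ _ _ _ [].
Qed.

(* Main.v *)
(* For a dual feasible point and each scenario s, weak LP duality for the
   follower's problem gives chi^s . c + sigma^s . b >= 0 (when gamma^s = 0,
   boundedness of the follower's polyhedron forces chi^s = 0), so the aggregate
   constraint makes every term vanish; hence chi^s / gamma^s is optimal for the
   follower whenever gamma^s > 0, and the dual objective is at most E_gamma Psi.
   Conversely, scaling optimal primal-dual pairs of the follower by weights p in
   the ambiguity set gives dual feasible points of value arbitrarily close to
   E_p Psi.  The gamma-part of the dual constraints describes exactly Ddis, so
   dual optimality of D yields E_p Psi <= E_gamma Psi.  No strong duality is
   needed for the semidefinite program, only Farkas' lemma for the follower. *)
Require Import Defs.
From mathcomp Require Import all_boot all_order all_algebra.
From mathcomp Require Import ring lra.
From mathcomp Require Import all_classical all_reals all_analysis.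
Import Order.TTheory GRing.Theory Num.Theory.
Import numFieldNormedType.Exports.
Local Open Scope classical_set_scope.
Local Open Scope ring_scope.

(** * Farkas' lemma for finitely many linear functionals *)

Section Farkas.
Set Implicit Arguments.
Unset Strict Implicit.
Variables (R : realFieldType) (V : lmodType R).

(* Eliminating the functional [a j] along a vector [x0] that violates the
   claim for the remaining functionals and satisfies [a j x0 > 0] reduces the
   number of functionals by one. *)
Lemma farkas_seq (I : eqType) (r : seq I) (a : I -> V -> R) (c : V -> R) :
  uniq r -> (forall i, scalar (a i)) -> scalar c ->
  (forall x, (forall i, i \in r -> a i x <= 0) -> c x <= 0) ->
  exists u : I -> R, (forall i, 0 <= u i) /\
    forall x, c x = \sum_(i <- r) u i * a i x.
Proof.
elim: r a c => [|j r IH] a c /=.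
  move=> _ _ cl c0; exists (fun=> 0); split => // x; rewrite big_nil.
  have c00 : c 0 = 0 by have := cl 1 0 0; rewrite scaler0 addr0; lra.
  have := c0 x (fun _ => ltac:(by [])).
  have := c0 (- x) (fun _ => ltac:(by [])).
  have := cl (-1) x 0; rewrite scaleN1r addr0 c00; lra.
move=> /andP[jr ur] al cl hc.
have [h|] := pselect (forall x, (forall i, i \in r -> a i x <= 0) -> c x <= 0).
  have [u [u0 uE]] := IH a c ur al cl h.
  exists (fun i => if i == j then 0 else u i); split.
    by move=> i; case: ifP.
  move=> x; rewrite big_cons eqxx mul0r add0r uE.
  by apply: eq_big_seq => i ir; case: eqP => // ij; move: jr; rewrite -ij ir.
move=> /existsNP[x0 /not_implyP[ax0 /negP]]; rewrite -ltNge => cx0.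
have jx0 : 0 < a j x0.
  rewrite ltNge; apply/negP => jx0.
  suff : c x0 <= 0 by rewrite leNgt cx0.
  by apply: hc => i; rewrite inE => /orP[/eqP -> //|]; exact: ax0.
(* The functional below is [f] evaluated at the projection of [x] to the kernel of [a j] along
   [x0]. *)
have linK (f : V -> R) (fl : scalar f) :
    scalar (fun x => f x - f x0 / a j x0 * a j x).
  by move=> e x y; rewrite fl al; ring.
have linS (f : V -> R) (fl : scalar f) x :
    f (- (a j x / a j x0) *: x0 + x) = f x - f x0 / a j x0 * a j x.
  by rewrite fl; ring.
have [|u [u0 uE]] := IH _ _ ur (fun i => linK _ (al i)) (linK _ cl).
  move=> x hx; rewrite -linS//; apply: hc => i; rewrite linS// inE.
  case/orP => [/eqP ->|]; last exact: hx.
  by rewrite mulfV ?gt_eqF// mul1r subrr.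
(* Undoing the projection leaves [(c x0 - S) / a j x0] as the coefficient of [a j]; it is
   nonnegative because [c x0 > 0 >= S]. *)
pose S := \sum_(i <- r) u i * a i x0.
have S0 : S <= 0.
  rewrite /S big_seq; apply: sumr_le0 => i ir.
  exact: mulr_ge0_le0 (u0 i) (ax0 i ir).
exists (fun i => if i == j then (c x0 - S) / a j x0 else u i); split.
  by move=> i; case: eqP => // _; apply: divr_ge0; lra.
move=> x; rewrite big_cons eqxx.
have -> : \sum_(i <- r) (if i == j then (c x0 - S) / a j x0 else u i) * a i x =
    \sum_(i <- r) u i * a i x.
  by apply: eq_big_seq => i ir; case: eqP => // ij; move: jr; rewrite -ij ir.
have := uE x.
have -> : \sum_(i <- r) u i * (a i x - a i x0 / a j x0 * a j x) =
    \sum_(i <- r) u i * a i x - S / a j x0 * a j x.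
  rewrite /S !mulr_suml -sumrB; apply: eq_bigr => i _; ring.
move=> /(canRL (subrK _)) ->; ring.
Qed.

(** The ambient module stays arbitrary so that pairs of a vector and a homogenizing scalar are
    covered. *)
Lemma farkas (I : finType) (a : I -> V -> R) (c : V -> R) :
  (forall i, scalar (a i)) -> scalar c ->
  (forall x, (forall i, a i x <= 0) -> c x <= 0) ->
  exists u : I -> R, (forall i, 0 <= u i) /\
    forall x, c x = \sum_i u i * a i x.
Proof.
move=> al cl hc; apply: farkas_seq => //; first exact: index_enum_uniq.
by move=> x hx; apply: hc => i; apply: hx; rewrite mem_index_enum.
Qed.

End Farkas.

(** * Primal and dual attainment over a nonempty bounded polyhedron *)

Section LinearProgramming.
Set Implicit Arguments.
Unset Strict Implicit.
Variables (R : realType) (m n : nat).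
Implicit Types (A : 'M[R]_(m, n)) (b : 'cV[R]_m) (c : 'cV[R]_n).

Lemma ge0_lev p (u : 'cV[R]_p) : lev 0 u <-> forall i, 0 <= u i 0.
Proof. by split=> h i; have := h i; rewrite mxE. Qed.

Lemma dotv_inj p (u v : 'cV[R]_p) : (forall w, dotv u w = dotv v w) -> u = v.
Proof.
move=> h; apply/colP => i; have := h (delta_mx i 0); rewrite !dotvE.
have E (w : 'cV[R]_p) : \sum_j w j 0 * (delta_mx i 0 : 'cV[R]_p) j 0 = w i 0.
  rewrite (bigD1 i)//= big1 ?addr0 => [|j /negbTE ji]; rewrite !mxE ?eqxx/=.
    by rewrite mulr1.
  by rewrite ji mulr0.
by rewrite !E.
Qed.

Lemma bounded_set_dotv (P : set 'cV[R]_n) : bounded_set P ->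
  forall c, exists M : R, forall y, P y -> `|dotv c y| <= M.
Proof.
move=> [M0 [_ hM]] c; have {}hM := hM (M0 + 1) (ltr_pwDr ltr01 (lexx _)).
exists (\sum_i `|c i 0| * (M0 + 1)) => y /hM /= yM.
rewrite dotvE; apply: le_trans (ler_norm_sum _ _ _) _.
apply: ler_sum => i _; rewrite normrM ler_wpM2l//.
apply: le_trans yM; have -> : `|y| = mx_norm y by [].
rewrite mx_normrE.
by apply: (le_bigmax _ (fun ij : 'I_n * 'I_1 => `|y ij.1 ij.2|) (i, 0)).
Qed.

(** Along a nonzero recession direction some linear functional would be unbounded on the
    polyhedron. *)
Lemma polyhedron_recession A b z :
  [set y | lev (A *m y) b] !=set0 -> bounded_set [set y | lev (A *m y) b] ->
  lev (A *m z) 0 -> z = 0.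
Proof.
move=> [y0 /= y0b] bd zr; apply: dotv_inj => w; rewrite dotv0l dotvC.
have ray (t : R) : 0 <= t -> lev (A *m (y0 + t *: z)) b.
  move=> t0 i; have := y0b i; have := zr i.
  rewrite mulmxDr -scalemxAr !mxE => zi yi.
  by have := mulr_ge0_le0 t0 zi; lra.
have [M hM] := bounded_set_dotv bd w.
have [//|wz] := eqVneq (dotv w z) 0.
(* With this [t], the functional [w] has absolute value at least [M + 1] at [y0 + t *: z]. *)
pose t := (M + `|dotv w y0| + 1) / `|dotv w z|.
have M0 : 0 <= M by apply: le_trans (hM _ y0b).
have t0 : 0 <= t by rewrite divr_ge0// !addr_ge0.
have := hM _ (ray _ t0); rewrite dotvDr dotvZr.
have tE : `|t * dotv w z| = M + `|dotv w y0| + 1.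
  by rewrite normrM (ger0_norm t0) /t divfK// normr_eq0.
have := ler_normB (dotv w y0 + t * dotv w z) (dotv w y0).
rewrite addrC addKr tE; lra.
Qed.

(* R^o supplies the lmodType structure on the homogenizing coordinate x.2. *)
Let homog A b i (x : 'cV[R]_n * R^o) : R := (A *m x.1) i 0 - x.2 * b i 0.

Let homog_scalar A b i : scalar (homog A b i).
Proof.
by move=> e x y; rewrite /homog /= mulmxDr -scalemxAr !mxE /GRing.scale/=; ring.
Qed.

Let sum_homog A b u x :
  \sum_i u i * homog A b i x =
  dotv (A^T *m (\col_i u i)) x.1 - x.2 * dotv b (\col_i u i).
Proof.
rewrite -[A]trmxK -dotv_adj trmxK (dotvC b) !dotvE mulr_sumr -sumrB.
by apply: eq_bigr => i _; rewrite /homog !mxE; ring.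
Qed.

(** Farkas' lemma on the cone over the polyhedron, where [inr tt] encodes [0 <= x.2]: optimality of
    [ys] makes [x.2 * dotv c ys - dotv c x.1] nonpositive there, and the multipliers of the rows
    form [sg]. *)
Lemma lp_dual_attained A b c ys :
  [set y | lev (A *m y) b] !=set0 -> bounded_set [set y | lev (A *m y) b] ->
  lev (A *m ys) b ->
  (forall y, lev (A *m y) b -> dotv c ys <= dotv c y) ->
  exists sg : 'cV[R]_m,
    [/\ lev 0 sg, c + A^T *m sg = 0 & dotv ys c + dotv sg b <= 0].
Proof.
move=> ne bd ysb opt.
pose a (o : 'I_m + unit) (x : 'cV[R]_n * R^o) : R :=
  if o is inl i then homog A b i x else - x.2.
have [|||u [u0 uE]] := @farkas _ _ _ a
    (fun x => x.2 * dotv c ys - dotv c x.1).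
- case=> [i|[]] /=; first exact: homog_scalar.
  by move=> e x y; rewrite /a /= /GRing.scale/=; ring.
- by move=> e x y; rewrite /= dotvDr dotvZr /GRing.scale/=; ring.
- case=> z t h /=.
  have t0 : 0 <= t by have := h (inr tt); rewrite /a/=; lra.
  have zb i : (A *m z) i 0 <= t * b i 0.
    by have := h (inl i); rewrite /a/= /homog/=; lra.
  (* For [t = 0] the point is a recession direction, hence zero; for [t > 0] it rescales to a
     feasible point. *)
  have [t00|t00] := eqVneq t 0.
    rewrite t00 mul0r (@polyhedron_recession A b z)// ?dotv0r ?subrr// => i.
    by rewrite [leRHS]mxE; have := zb i; rewrite t00 mul0r.
  have tp : 0 < t by rewrite lt_def t00.
  have : dotv c ys <= dotv c (t^-1 *: z).
    apply: opt => i; rewrite -scalemxAr mxE.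
    by rewrite mulrC ler_pdivrMr// mulrC.
  by rewrite dotvZr mulrC ler_pdivlMr// mulrC; lra.
exists (\col_i u (inl i)).
have E x : x.2 * dotv c ys - dotv c x.1 =
    dotv (A^T *m (\col_i u (inl i))) x.1 - x.2 * dotv b (\col_i u (inl i))
    - u (inr tt) * x.2.
  rewrite uE big_sumType /= /a sum_homog; congr (_ + _).
  by rewrite (bigD1 tt)//= big1 ?addr0 ?mulrN// => -[].
(* [E] at [(z, 0)] gives the equation; at [(0, 1)] it gives the gap, equal to [- u (inr tt)]. *)
split.
- by apply/ge0_lev => i; rewrite mxE.
- apply: dotv_inj => z; rewrite dotvDl dotv0l.
  by have /= := E (z, 0); lra.
- have /= := E (0, 1); rewrite !dotv0r (dotvC ys) (dotvC _ b).
  by have := u0 (inr tt); lra.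
Qed.

(* If no feasible point attained the infimum, the Farkas multiplier [w] of the
   objective row would give 1 <= w * (c y - inf E) for every feasible y. *)
Lemma lp_primal_attained A b c :
  [set y | lev (A *m y) b] !=set0 -> bounded_set [set y | lev (A *m y) b] ->
  exists ys : 'cV[R]_n, lev (A *m ys) b /\
    forall y, lev (A *m y) b -> dotv c ys <= dotv c y.
Proof.
move=> ne bd; pose E := [set dotv c y | y in [set y | lev (A *m y) b]].
have Eb : has_lbound E.
  have [M hM] := bounded_set_dotv bd c; exists (- M) => _ [y /hM + <-].
  by rewrite ler_norml => /andP[].
have Ei : has_inf E by split=> //; case: ne => y yb; exists (dotv c y), y.
have lb y : lev (A *m y) b -> inf E <= dotv c y.
  by move=> yb; apply: ge_inf => //; exists y.
apply: contrapT => no.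
pose a (o : 'I_m + unit) (x : 'cV[R]_n * R^o) : R :=
  if o is inl i then homog A b i x else dotv c x.1 - x.2 * inf E.
have [|||u [u0 uE]] := @farkas _ _ _ a (fun x => x.2).
- case=> [i|[]] /=; first exact: homog_scalar.
  by move=> e x y; rewrite /a /= dotvDr dotvZr /GRing.scale/=; ring.
- by [].
(* A cone point with [t > 0] would rescale to a minimizer, so [x.2] is nonpositive on this cone. *)
- case=> z t h /=; rewrite leNgt; apply/negP => tp; apply: no.
  exists (t^-1 *: z); split=> [i|y yb].
    rewrite -scalemxAr mxE mulrC ler_pdivrMr// mulrC.
    by have := h (inl i); rewrite /a/= /homog/=; lra.
  apply: le_trans (lb _ yb); rewrite dotvZr mulrC ler_pdivrMr// mulrC.
  by have := h (inr tt); rewrite /a/=; lra.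
set w := u (inr tt) in uE.
have {}uE x : x.2 =
    dotv (A^T *m (\col_i u (inl i))) x.1 - x.2 * dotv b (\col_i u (inl i))
    + w * (dotv c x.1 - x.2 * inf E).
  rewrite [LHS]uE big_sumType /= /a sum_homog; congr (_ + _).
  by rewrite (bigD1 tt)//= big1 ?addr0// => -[].
have gap y : lev (A *m y) b -> 1 <= w * (dotv c y - inf E).
  move=> yb; have /= := uE (y, 1).
  rewrite -[A]trmxK -dotv_adj trmxK !mul1r (dotvC b).
  suff : dotv (\col_i u (inl i)) (A *m y) <= dotv (\col_i u (inl i)) b by lra.
  by apply: lev_dotv => //; apply/ge0_lev => i; rewrite mxE.
have w0 : 0 <= w by exact: u0.
have w1 : 0 < w + 1 by lra.
(* A point within [(w + 1)^-1] of the infimum has [w * (dotv c y - inf E) <= w / (w + 1) < 1],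
   contradicting [gap], even when [w = 0]. *)
have wV0 : 0 < (w + 1)^-1 by rewrite invr_gt0.
have [_ [y yb <-] /ltW yE] := inf_adherent wV0 Ei.
have : w * (dotv c y - inf E) <= w * (w + 1)^-1.
  by apply: ler_wpM2l => //; lra.
have : (w + 1) * (w + 1)^-1 = 1 by rewrite mulfV ?gt_eqF.
by have := gap y yb; lra.
Qed.

End LinearProgramming.

(** * The ambiguity set in the variables of the dual program *)

Section AmbiguitySet.
Set Implicit Arguments.
Unset Strict Implicit.
Variables (R : realType) (k N : nat).

Lemma norm2_le1 (u : 'cV[R]_k) : (norm2 u <= 1) = (dotv u u <= 1).
Proof. by rewrite /norm2 -{1}sqrtr1 ler_sqrt. Qed.

Lemma dotv_eq0 (u : 'cV[R]_k) : dotv u u <= 0 -> u = 0.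
Proof.
rewrite dotvE => h; apply/colP => i; rewrite mxE; apply/eqP.
rewrite -sqrf_eq0 expr2 eq_le -expr2 sqr_ge0 andbT.
apply: le_trans h; rewrite (bigD1 i)//= -expr2 lerDl.
by apply: sumr_ge0 => j _; rewrite -expr2 sqr_ge0.
Qed.

Lemma posdef_unitmx (M : 'M[R]_k) : posdef M -> M \in unitmx.
Proof.
move=> [Ms Mp]; rewrite unitmxE unitfE; apply/det0P => -[v v0 vM].
have := Mp v^T; rewrite -Ms -trmx_mul vM trmx0 dotv0r ltxx.
suff -> : v^T != 0 by move=> /(_ isT).
by apply: contraNneq v0 => /(congr1 trmx); rewrite trmxK trmx0 => ->.
Qed.

Lemma sqrt_unitmx (M S : 'M[R]_k) : posdef M -> S *m S = M -> S \in unitmx.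
Proof. by move=> /posdef_unitmx + SM; rewrite -SM unitmx_mul => /andP[]. Qed.

(** The two outer factors [S] cancel the inverse of [S *m S], which maps the ellipsoid to a
    Euclidean ball. *)
Lemma sqrt_quad_form (M S : 'M[R]_k) (f : 'cV[R]_k) :
  posdef M -> is_psd_sqrt M S ->
  dotv (S *m f) (invmx M *m (S *m f)) = dotv f f.
Proof.
move=> Mp [[Ss _] SM]; have Su := sqrt_unitmx Mp SM.
rewrite dotvC dotv_adj Ss -SM.
have -> : invmx (S *m S) = invmx S *m invmx S.
  by rewrite -[RHS]mul1mx -(mulVmx (posdef_unitmx Mp)) -SM -!mulmxA
    (mulKVmx Su) mulmxV// mulmx1.
by rewrite -!mulmxA (mulKmx Su) mulKVmx.
Qed.

Lemma centered_second_moment (g : 'I_N -> R) (xi : 'I_N -> 'cV[R]_k)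
    (mu : 'cV[R]_k) : \sum_s g s = 1 ->
  \sum_s g s *: ((xi s - mu) *m (xi s - mu)^T) =
  \sum_s g s *: (xi s *m (xi s)^T) - (\sum_s g s *: xi s) *m mu^T
  - mu *m (\sum_s g s *: xi s)^T + mu *m mu^T.
Proof.
move=> g1; rewrite -[X in _ + X]scale1r -g1 scaler_suml.
rewrite mulmx_suml [X in mu *m X]linear_sum/= mulmx_sumr -!sumrB -big_split/=.
by apply: eq_bigr => s _; apply/matrixP => i j; rewrite !mxE !big_ord1 !mxE; ring.
Qed.

(* [mu] is the mean deviation in the coordinates where the ellipsoid of
   [Ddis] becomes the unit ball; at gamma1 = 0 any [mu] in the ball does. *)
Lemma DdisP (G : ambiguity_data R k N) (Sh : 'M[R]_k) (p : 'I_N -> R) :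
  posdef (Sigma0 G) -> is_psd_sqrt (Sigma0 G) Sh -> 0 <= gamma1 G ->
  Ddis G p <->
  [/\ forall s, 0 <= p s, \sum_s p s = 1 &
    exists mu, [/\
      psd (gamma2 G *: Sigma0 G + mu0 G *m (mu0 G)^T
           - \sum_s p s *: (scen G s *m (scen G s)^T)
           + Num.sqrt (gamma1 G) *: (mu0 G *m mu^T *m Sh
                                     + Sh *m mu *m (mu0 G)^T)),
      Num.sqrt (gamma1 G) *: (Sh *m mu) + mu0 G
        - \sum_s p s *: scen G s = 0 &
      norm2 mu <= 1]].
Proof.
move=> Sp Sh2 g1; have [[Shs _] ShS] := Sh2.
have Su := sqrt_unitmx Sp ShS.
set a := Num.sqrt (gamma1 G); set m := \sum_s p s *: scen G s.
have a0 : 0 <= a by exact: sqrtr_ge0.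
have a2 : a * a = gamma1 G by rewrite -expr2 sqr_sqrtr.
(* Once the mean is written through [mu], the dual matrix is the slack of the Loewner constraint. *)
have E mu : \sum_s p s = 1 -> m = a *: (Sh *m mu) + mu0 G ->
    gamma2 G *: Sigma0 G + mu0 G *m (mu0 G)^T
    - \sum_s p s *: (scen G s *m (scen G s)^T)
    + a *: (mu0 G *m mu^T *m Sh + Sh *m mu *m (mu0 G)^T) =
    gamma2 G *: Sigma0 G
    - \sum_s p s *: ((scen G s - mu0 G) *m (scen G s - mu0 G)^T).
  move=> p1 mE; rewrite centered_second_moment// -/m mE.
  rewrite [(_ + mu0 G)^T]linearD/= [(_ *: _)^T]linearZ/= trmx_mul Shs.
  rewrite mulmxDl mulmxDr -scalemxAl -scalemxAr scalerDr (mulmxA (mu0 G)).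

  move: (mu0 G *m (mu0 G)^T) (a *: _) (a *: _) (\sum_i _) (_ *: _).
  by move=> Y1 Y2 Y3 Y4 Y5; apply/matrixP => i j; rewrite !mxE; ring.
split.
  move=> [p0 p1 pe pS]; split => //.
  pose f := invmx Sh *m (m - mu0 G).
  have fE : Sh *m f = m - mu0 G by rewrite /f mulKVmx.
  move: pe; rewrite /= -/m -fE sqrt_quad_form// -a2 => ff.
  have mE : m = a *: (Sh *m (a^-1 *: f)) + mu0 G.
    (* At [a = 0] the default [a^-1 = 0] selects [mu = 0], and [f] vanishes since
       [dotv f f <= a * a]. *)
    have [az|an] := eqVneq a 0.
      move: ff fE; rewrite az mul0r scale0r add0r => /dotv_eq0 ->.
      by rewrite mulmx0 => /eqP; rewrite eq_sym subr_eq0 => /eqP.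
    by rewrite -scalemxAr scalerA mulfV// scale1r fE subrK.
  exists (a^-1 *: f); split.
  - by rewrite E.
  - by rewrite -mE subrr.
  - rewrite norm2_le1 dotvZl dotvZr mulrA.
    have [->|an] := eqVneq a 0; first by rewrite invr0 !mul0r.
    by rewrite -invfM mulrC ler_pdivrMr ?mul1r// lt_def mulf_neq0// mulr_ge0.
move=> [p0 p1 [mu [Mpsd /eqP]]]; rewrite subr_eq0 eq_sym => /eqP mE.
rewrite norm2_le1 => mu1; split => //.
  rewrite /= -/m mE addrK -scalemxAr dotvZl dotvZr sqrt_quad_form// mulrA a2.
  by rewrite ler_piMr.
by rewrite /loewner_le -(E mu).
Qed.

End AmbiguitySet.

(** * A single scenario: dual blocks and the follower's value *)

Section FollowerValue.
Set Implicit Arguments.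
Unset Strict Implicit.
Variables (R : realType) (d m n k N : nat).
Variables (F : follower_data R d m n k) (x : {ffun 'I_d -> bool}).
Variable z : 'cV[R]_k.
Hypothesis feas_ne : follower_feasible F x z !=set0.
Hypothesis feas_bd : bounded_set (follower_feasible F x z).

Lemma has_sup_Omega : has_sup [set dotv (cost_v F z) y | y in Omega F x z].
Proof.
split.
  have [y [yb yo]] := lp_primal_attained (cost_c F z) feas_ne feas_bd.
  by exists (dotv (cost_v F z) y), y.
have [M hM] := bounded_set_dotv feas_bd (cost_v F z).
by exists M => _ [y [/hM + _] <-]; exact: le_trans (ler_norm _).
Qed.

(** Pairing [sg >= 0] with the rows satisfied by [y] bounds the [b]-term from below, and the
    equation for [sg] rewrites this bound through the cost. *)
Lemma scaled_pair_duality_gap (g : R) (ch y : 'cV[R]_n) (sg : 'cV[R]_m) :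
  g *: cost_c F z + (mxA F)^T *m sg = 0 -> lev 0 sg ->
  follower_feasible F x z y ->
  dotv ch (cost_c F z) - g * dotv (cost_c F z) y
    <= dotv ch (cost_c F z) + dotv sg (rhs_b F x z).
Proof.
move=> Dsg sg0 yb; have := lev_dotv sg0 yb; rewrite dotv_adj.
move/eqP: Dsg; rewrite addrC addr_eq0 => /eqP ->.
by rewrite -scaleN1r !dotvZl; lra.
Qed.

Lemma scaled_feasible (g : R) (ch : 'cV[R]_n) : 0 < g ->
  lev 0 (- (mxA F *m ch) + g *: rhs_b F x z) ->
  follower_feasible F x z (g^-1 *: ch).
Proof.
move=> g0 h i; rewrite -scalemxAr mxE mulrC ler_pdivrMr// mulrC.
by have := h i; rewrite !mxE; lra.
Qed.

Lemma scaled_feasible0 (ch : 'cV[R]_n) :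
  lev 0 (- (mxA F *m ch) + 0 *: rhs_b F x z) -> ch = 0.
Proof.
move=> h; apply: (polyhedron_recession feas_ne feas_bd) => i.
by have := h i; rewrite scale0r addr0 !mxE; lra.
Qed.

Lemma scaled_pair_gap_ge0 (g : R) (ch : 'cV[R]_n) (sg : 'cV[R]_m) : 0 <= g ->
  lev 0 (- (mxA F *m ch) + g *: rhs_b F x z) ->
  g *: cost_c F z + (mxA F)^T *m sg = 0 -> lev 0 sg ->
  0 <= dotv ch (cost_c F z) + dotv sg (rhs_b F x z).
Proof.
rewrite le_eqVlt => /predU1P[<- /scaled_feasible0 -> Dsg sg0|g0 chb Dsg sg0].
  have [y yb] := feas_ne.
  by have := scaled_pair_duality_gap 0 Dsg sg0 yb; rewrite dotv0l; lra.
(* Comparing with [y = g^-1 *: ch] itself makes the lower bound zero. *)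
apply: le_trans (scaled_pair_duality_gap ch Dsg sg0 (scaled_feasible g0 chb)).
by rewrite dotvZr mulVKf ?gt_eqF// dotvC subrr.
Qed.

(** For [g > 0] the nonpositive gap puts [g^-1 *: ch] in [Omega]; for [g = 0] both sides vanish. *)
Lemma scaled_pair_le_Psi (g : R) (ch : 'cV[R]_n) (sg : 'cV[R]_m) : 0 <= g ->
  lev 0 (- (mxA F *m ch) + g *: rhs_b F x z) ->
  g *: cost_c F z + (mxA F)^T *m sg = 0 -> lev 0 sg ->
  dotv ch (cost_c F z) + dotv sg (rhs_b F x z) <= 0 ->
  dotv ch (cost_v F z) <= g * Psi F x z.
Proof.
rewrite le_eqVlt => /predU1P[<- /scaled_feasible0 -> *|g0 chb Dsg sg0 gap].
  by rewrite dotv0l mul0r.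
rewrite -ler_pdivrMl// -dotvZl dotvC; apply: ub_le_sup.
  by case: has_sup_Omega.
exists (g^-1 *: ch) => //; split; first exact: scaled_feasible.
move=> y yb; rewrite dotvZr ler_pdivrMl// dotvC.
by have := scaled_pair_duality_gap ch Dsg sg0 yb; lra.
Qed.

(** An [e]-maximizer over [Omega] is a follower optimum, so LP duality supplies its multipliers. *)
Lemma Psi_attained_pair (e : R) : 0 < e ->
  exists w : 'cV[R]_n * 'cV[R]_m,
  [/\ lev (mxA F *m w.1) (rhs_b F x z),
      cost_c F z + (mxA F)^T *m w.2 = 0, lev 0 w.2,
      dotv w.1 (cost_c F z) + dotv w.2 (rhs_b F x z) <= 0 &
      Psi F x z - e <= dotv w.1 (cost_v F z)].
Proof.
move=> e0; have [_ [y [yb yo] <-] ye] := sup_adherent e0 has_sup_Omega.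
have [sg [sg0 sgE gap]] := lp_dual_attained feas_ne feas_bd yb yo.
by exists (y, sg); split => //; rewrite (dotvC y) ltW.
Qed.

End FollowerValue.

(** * Dual objective versus expected follower value *)

Section DualProgram.
Set Implicit Arguments.
Unset Strict Implicit.
Variables (R : realType) (d m n k N : nat).
Variables (F : follower_data R d m n k) (G : ambiguity_data R k N).
Variables (Sh : 'M[R]_k) (x : {ffun 'I_d -> bool}).
Hypothesis Sp : posdef (Sigma0 G).
Hypothesis ShS : is_psd_sqrt (Sigma0 G) Sh.
Hypothesis g1 : 0 <= gamma1 G.
Hypothesis recourse : forall s, follower_feasible F x (scen G s) !=set0 /\
  bounded_set (follower_feasible F x (scen G s)).

Lemma dual_objective_le_expected_Psi (D : dual_point R m n k N) :
  dual_feasible F G Sh x D ->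
  dual_objective F G D <= expected_Psi F G x (dgamma D).
Proof.
move=> [_ _ _ _ [chb Dsg gap g0 sg0]]; apply: ler_sum => s _.
have [ne bd] := recourse s.
apply: (scaled_pair_le_Psi ne bd (g0 s) (chb s) (Dsg s) (sg0 s)).
apply: le_trans gap; rewrite (bigD1 s)//= lerDl; apply: sumr_ge0 => j _.
have [nej bdj] := recourse j.
exact: (scaled_pair_gap_ge0 nej bdj (g0 j) (chb j) (Dsg j) (sg0 j)).
Qed.

Lemma expected_Psi_le_dual_objective (p : 'I_N -> R) (e : R) :
  Ddis G p -> 0 < e -> exists D, dual_feasible F G Sh x D /\
    expected_Psi F G x p - e <= dual_objective F G D.
Proof.
move=> /(DdisP p Sp ShS g1)[p0 p1 [mu [Mpsd mE mu1]]] e0.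
have /choice[w hw] s := Psi_attained_pair (recourse s).1 (recourse s).2 e0.
exists (DualPoint p (fun s => p s *: (w s).2) (fun s => p s *: (w s).1) mu).
split.
  split => //=; split => //= [s|s||s].
  - have [wb _ _ _ _] := hw s; apply/ge0_lev => i.
    have := ler_wpM2l (p0 s) (wb i).
    by rewrite -scalemxAr !mxE; lra.
  - have [_ wE _ _ _] := hw s.
    by rewrite -scalemxAr -scalerDr wE scaler0.
  - apply: sumr_le0 => s _; have [_ _ _ gap _] := hw s.
    by rewrite !dotvZl -mulrDr mulr_ge0_le0.
  - have [_ _ w0 _ _] := hw s; apply/ge0_lev => i.
    by rewrite mxE mulr_ge0//; move/ge0_lev : w0.
(* As the weights sum to 1, the errors [e] of the scenarios average to [e]. *)
rewrite /dual_objective /expected_Psi/= -[e]mul1r -p1 mulr_suml -sumrB.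
apply: ler_sum => s _; rewrite -mulrBr dotvZl ler_wpM2l//.
by have [] := hw s.
Qed.

End DualProgram.

Theorem theorem5 (R : realType) (d m n k N : nat)
    (X : {set {ffun 'I_d -> bool}})
    (F : follower_data R d m n k) (G : ambiguity_data R k N)
    (Sigma0_half : 'M[R]_k)
    (hSigma0 : posdef (Sigma0 G))
    (hSigma0_half : is_psd_sqrt (Sigma0 G) Sigma0_half)
    (hgamma1 : 0 <= gamma1 G) (hgamma2 : 1 <= gamma2 G)
    (hrecourse : relatively_complete_recourse F G X)
    (xhat : {ffun 'I_d -> bool}) (hxhat : xhat \in X)
    (D : dual_point R m n k N)
    (hD : dual_optimal F G Sigma0_half xhat D) :
  Ddis G (dgamma D) /\
  (expected_Psi F G xhat (dgamma D))%:E =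
    ereal_sup [set (expected_Psi F G xhat p)%:E | p in Ddis G].
Proof.
have rec s := hrecourse xhat s hxhat.
have [Df Dopt] := hD.
have DD : Ddis G (dgamma D).
  apply/(DdisP _ hSigma0 hSigma0_half hgamma1).
  by case: Df => [Mpsd p1 mE mu1 [_ _ _ g0 _]]; split => //; exists (dmu D).
split=> //; apply/eqP; rewrite eq_le; apply/andP; split.
  by apply: ereal_sup_ubound; exists (dgamma D).
apply: ge_ereal_sup => _ [p pD <-]; rewrite lee_fin.
apply/ler_addgt0Pr => e e0.
have [D' [D'f D'e]] :=
  expected_Psi_le_dual_objective hSigma0 hSigma0_half hgamma1 rec pD e0.
rewrite -lerBlDr; apply: le_trans D'e _; apply: le_trans (Dopt _ D'f) _.
exact: (dual_objective_le_expected_Psi rec Df).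
Qed.
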